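(* Consider the colinear $4$ body problem with positive masses $m_1,m_2,m_3,m_4$, with potential $V=V_{4,1}$. Let $c$ be the real central configuration with multiplier $-1$ (which exists and is unique up to translation), and let $W\in M_4(\mathbb{C})$ be the matrix $$W_{i,j}=\frac{1}{m_i}\frac{\partial^2 V}{\partial q_i\partial q_j}(c),\qquad i,j=1,\dots,4 .$$ Then $\operatorname{tr}(W)<70$.
   Context: $V_{4,1}(q)=\sum_{1\le i<j\le4}\frac{m_im_j}{|q_i-q_j|}$ for $q\in\mathbb{R}^4$ with the bodies in the fixed order $q_1<q_2<q_3<q_4$. A central configuration is a $c$ for which there exist $g,\alpha$ with $\frac1{m_i}\frac{\partial V}{\partial q_i}(c)=\alpha(c_i-g)$ for $i=1,\dots,4$; $\alpha$ is the multiplier. By a theorem of Moulton, for positive masses with a fixed order there is exactly one real central configuration up to translation and dilatation; requiring multiplier $-1$ fixes the dilatation. *)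

(* Defs.v *)
From HB Require Import structures.
From mathcomp Require Import all_boot all_order all_algebra.
From mathcomp Require Import all_classical all_reals all_analysis.
From mathcomp Require Import complex.

Set Implicit Arguments.
Unset Strict Implicit.
Unset Printing Implicit Defensive.

Import Order.TTheory GRing.Theory Num.Theory.
Import numFieldNormedType.Exports.
Local Open Scope ring_scope.
Local Open Scope complex_scope.

(* Indices run from 0 to 3, so m 0, ..., m 3 are m_1, ..., m_4. *)
Definition V41 (R : realType) (m : 'I_4 -> R) (q : 'rV[R]_4) : R :=
  \sum_(i < 4) \sum_(j < 4 | (i < j)%N) m i * m j / `|q 0 i - q 0 j|.

(* 'D_v f q is total, with a junk value where f is not derivable; it is only
   evaluated below at collision-free points, near which V41 m is smooth. *)
Definition partial (R : realType) (i : 'I_4) (f : 'rV[R]_4 -> R)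
    (q : 'rV[R]_4) : R :=
  'D_(delta_mx 0 i) f q.

Definition ordered_bodies (R : realType) (q : 'rV[R]_4) : Prop :=
  forall i j : 'I_4, (i < j)%N -> q 0 i < q 0 j.

Definition central_configuration (R : realType) (m : 'I_4 -> R) (alpha : R)
    (c : 'rV[R]_4) : Prop :=
  ordered_bodies c /\
  exists g : R, forall i : 'I_4,
    (m i)^-1 * partial i (V41 m) c = alpha * (c 0 i - g).

Definition W_mx (R : realType) (m : 'I_4 -> R) (c : 'rV[R]_4) : 'M[R[i]]_4 :=
  \matrix_(i < 4, j < 4) ((m i)^-1 * partial i (partial j (V41 m)) c)%:C.

(* Main.v *)
From Stdlib Require Import BinInt.
Require Import Defs.
From HB Require Import structures.
From mathcomp Require Import all_boot all_order all_algebra.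
From mathcomp Require Import all_classical all_reals all_analysis.
From mathcomp Require Import complex.
From mathcomp Require Import ssrZ ring lra.
Import Order.TTheory GRing.Theory Num.Theory.
Import numFieldNormedType.Exports.
Local Open Scope ring_scope.
Local Open Scope complex_scope.

Set Implicit Arguments.
Unset Strict Implicit.
Unset Printing Implicit Defensive.

(** Let x, y, z be the three gaps between consecutive bodies and r_ij the
mutual distances, which are sums of consecutive gaps. Differentiating the
potential twice gives tr W = 2 T with
T = sum_(i<j) (m_i + m_j) / r_ij^3, and subtracting the central configuration
equations of neighbouring bodies removes the centre g and leaves three
equations with left-hand sides x, y, z. Once the gaps are fixed, both T and
the three equations are linear in the masses: bounding T is a linear program
in four nonnegative unknowns with three constraints, and its maximum is
reached when some mass vanishes. It turns out to be the second mass when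
x <= z, hence the third one when z <= x, by reflection; so x <= z may be
assumed.

Concretely, solve the three equations for m_1, m_3, m_4 by Cramer's rule,
keeping m_2 on the right-hand side. After clearing denominators (n_2 is m_2
times a positive factor, Pi is the product of the distances, D the determinant
of the system, N(v) the combination of Cramer numerators which gives D times
the value of Pi T for the right-hand side v, K_2 and t_2 the contributions of
the second body to the equations and to Pi T), this reads
  D Pi T = N(x, y, z) - n_2 (N(K_2) - D t_2),
which is [cramer_excess]. The bound T <= 34.95 then follows from three
polynomial inequalities in x, y, z:
 - D > 0 ([system_det_gt0]);
 - N(K_2) >= D t_2 if x <= z ([massless_excess_ge0]): the second body
   contributes less to T than the bodies 1, 3, 4 that could replace it;
 - 699 Pi D >= 20 N(x, y, z) ([trace_gap_ge0]), the estimate for the limiting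
   case m_2 = 0.
The constant is close to optimal: the supremum of T is about 34.87, near the
gaps x : y : z = 35 : 7 : 58.

Each inequality is proved by a linear change of variables after which the
expanded polynomial has nonnegative coefficients. The first two need at most
the substitution z = x + d. In the third, the difference is relatively small
near the above gaps, and the octant is cut into six cones, five of which share
a ray close to them. The expansions, with a hundred or more terms of degree up
to 21, are computed by a small verified evaluator for polynomials in three
variables with integer coefficients ([nneg_coefsP]). *)

(** * Polynomials in three variables with nonnegative coefficients *)

(** The operations needed to compute with coefficients. They are packed
without any law, so that coefficients can be polynomials in turn; [sound]
relates them to a ring. *)
Record coefs := Coefs {
  coef :> Type;
  czero : coef;
  cadd : coef -> coef -> coef;
  copp : coef -> coef;
  cmul : coef -> coef -> coef;
  cnneg : coef -> bool }.

Definition Zcoefs : coefs := @Coefs Z Z.zero Z.add Z.opp Z.mul (Z.leb Z.zero).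

Fixpoint hadd (C : coefs) (s t : seq C) : seq C :=
  match s, t with
  | [::], _ => t
  | _, [::] => s
  | x :: s', y :: t' => cadd x y :: hadd s' t'
  end.

Definition hmul (C : coefs) (s t : seq C) : seq C :=
  foldr (fun x r => hadd [seq cmul x y | y <- t] (czero C :: r)) [::] s.

Definition horner_coefs (C : coefs) : coefs :=
  @Coefs (seq C) [::] (@hadd C) (map (@copp C)) (@hmul C) (all (@cnneg C)).

Record sound (R : realDomainType) (C : coefs) (ev : C -> R) : Prop := Sound {
  sound0 : ev (czero C) = 0;
  soundD : forall x y, ev (cadd x y) = ev x + ev y;
  soundN : forall x, ev (copp x) = - ev x;
  soundM : forall x y, ev (cmul x y) = ev x * ev y;
  sound_ge0 : forall x, cnneg x -> 0 <= ev x }.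

Definition horner_ev (R : realDomainType) (C : coefs) (ev : C -> R) (x : R)
    (s : seq C) : R :=
  foldr (fun y r => ev y + x * r) 0 s.

Lemma sound_horner (R : realDomainType) (C : coefs) (ev : C -> R) (x : R) :
  0 <= x -> sound ev -> sound (C := horner_coefs C) (horner_ev ev x).
Proof.
move=> x0 [e0 eD eN eM eP].
have hD s t : horner_ev ev x (hadd s t) = horner_ev ev x s + horner_ev ev x t.
  elim: s t => [|y s IH] [|z t] //=; rewrite ?add0r ?addr0 //.
  by rewrite eD IH; ring.
have hZ y s : horner_ev ev x [seq cmul y z | z <- s] = ev y * horner_ev ev x s.
  by elim: s => [|z s IH] /=; rewrite ?mulr0 // eM IH; ring.
split=> //.
- by elim=> [|y s IH] /=; rewrite ?oppr0 // eN IH; ring.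
- move=> s t; elim: s => [|y s IH] /=; first by rewrite mul0r.
  by rewrite hD hZ /= e0 IH; ring.
- elim=> [|y s IH] //= /andP[/eP y0 /IH s0].
  by rewrite addr_ge0 // mulr_ge0.
Qed.

Lemma sound_Z (R : realDomainType) :
  sound (C := Zcoefs) (fun z : Z => (int_of_Z z)%:~R : R).
Proof.
split=> //=.
- by move=> x y; rewrite -intrD -rmorphD.
- by move=> x; rewrite -intrN -rmorphN.
- by move=> x y; rewrite -intrM -rmorphM.
- by case.
Qed.

Inductive pexpr :=
  | PX | PY | PZ | PC of Z
  | PAdd of pexpr & pexpr | PSub of pexpr & pexpr | PMul of pexpr & pexpr.

Declare Scope pexpr_scope.
Delimit Scope pexpr_scope with P.
Bind Scope pexpr_scope with pexpr.
Notation "e + f" := (PAdd e f) : pexpr_scope.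
Notation "e - f" := (PSub e f) : pexpr_scope.
Notation "e * f" := (PMul e f) : pexpr_scope.

Fixpoint peval (R : realDomainType) (x y z : R) (e : pexpr) : R :=
  match e with
  | PX => x | PY => y | PZ => z | PC n => (int_of_Z n)%:~R
  | PAdd e f => peval x y z e + peval x y z f
  | PSub e f => peval x y z e - peval x y z f
  | PMul e f => peval x y z e * peval x y z f
  end.

Fixpoint psubst (u v w e : pexpr) : pexpr :=
  match e with
  | PX => u | PY => v | PZ => w | PC n => PC n
  | PAdd e f => PAdd (psubst u v w e) (psubst u v w f)
  | PSub e f => PSub (psubst u v w e) (psubst u v w f)
  | PMul e f => PMul (psubst u v w e) (psubst u v w f)
  end.

Definition coefs3 : coefs := horner_coefs (horner_coefs (horner_coefs Zcoefs)).

Fixpoint expand (e : pexpr) : coefs3 :=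
  match e with
  | PX => [:: [::]; [:: [:: Z.one]]]
  | PY => [:: [:: [::]; [:: Z.one]]]
  | PZ => [:: [:: [:: Z.zero; Z.one]]]
  | PC n => [:: [:: [:: n]]]
  | PAdd e f => cadd (expand e) (expand f)
  | PSub e f => cadd (expand e) (copp (expand f))
  | PMul e f => cmul (expand e) (expand f)
  end.

Definition nneg_coefs (e : pexpr) : bool := cnneg (expand e).

Definition nneg_octant (R : realDomainType) (e : pexpr) : Prop :=
  forall x y z : R, 0 <= x -> 0 <= y -> 0 <= z -> 0 <= peval x y z e.

(** The hypothesis is decided by computation on binary integers, which turns
an inequality over R into a closed boolean test. *)
Lemma nneg_coefsP (R : realDomainType) (e : pexpr) :
  nneg_coefs e -> nneg_octant R e.
Proof.
move=> e0 x y z x0 y0 z0.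
have S := sound_horner x0 (sound_horner y0 (sound_horner z0 (sound_Z R))).
set ev := horner_ev _ x in S.
suff -> : peval x y z e = ev (expand e) by exact: (sound_ge0 S).
have one : (int_of_Z Z.one)%:~R = 1 :> R by [].
have zero : (int_of_Z Z.zero)%:~R = 0 :> R by [].
elim: e {e0} => [||| n |e IHe f IHf|e IHe f IHf|e IHe f IHf] /=.
- by rewrite /ev /= ?one ?zero; ring.
- by rewrite /ev /= ?one ?zero; ring.
- by rewrite /ev /= ?one ?zero; ring.
- by rewrite /ev /= ?one ?zero; ring.
- by rewrite IHe IHf -(soundD S).
- by rewrite IHe IHf -(soundN S) -(soundD S).
- by rewrite IHe IHf -(soundM S).
Qed.

Lemma peval_subst (R : realDomainType) (x y z : R) (u v w e : pexpr) :
  peval x y z (psubst u v w e) =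
  peval (peval x y z u) (peval x y z v) (peval x y z w) e.
Proof. by elim: e => //= e -> f ->. Qed.

Lemma nneg_octant_subst (R : realDomainType) (u v w e : pexpr) :
  nneg_octant R (psubst u v w e) ->
  forall x y z : R, 0 <= x -> 0 <= y -> 0 <= z ->
  0 <= peval (peval x y z u) (peval x y z v) (peval x y z w) e.
Proof. by move=> H x y z *; rewrite -peval_subst H. Qed.

(** The octant is cut by the plane x = z, that is, by adding the ray
(1, 0, 1). *)
Lemma nneg_octant_split (R : realFieldType) (e : pexpr) :
  nneg_octant R (psubst (PX + PZ) PY PZ e) ->
  nneg_octant R (psubst PX PY (PZ + PX) e) -> nneg_octant R e.
Proof.
move=> /nneg_octant_subst /= H1 /nneg_octant_subst /= H2 x y z x0 y0 z0.
have [zx|/ltW xz] := leP z x.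
  by have := H1 (x - z) y z; rewrite subrK; apply; rewrite ?subr_ge0.
by have := H2 x y (z - x); rewrite subrK; apply; rewrite ?subr_ge0.
Qed.

(** Stellar subdivision: an inner ray r = (u, v, w) cuts the octant into the
three cones obtained by replacing one of the basis vectors by r. *)
Lemma nneg_octant_stellar (R : realFieldType) (u v w : Z) (e : pexpr) :
  0 < int_of_Z u -> 0 < int_of_Z v -> 0 < int_of_Z w ->
  nneg_octant R (psubst (PC u * PX) (PY + PC v * PX) (PZ + PC w * PX) e) ->
  nneg_octant R (psubst (PX + PC u * PY) (PC v * PY) (PZ + PC w * PY) e) ->
  nneg_octant R (psubst (PX + PC u * PZ) (PY + PC v * PZ) (PC w * PZ) e) ->
  nneg_octant R e.
Proof.
move=> u0 v0 w0 H1 H2 H3 x y z x0 y0 z0.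
move: (nneg_octant_subst H1) (nneg_octant_subst H2) (nneg_octant_subst H3).
move=> /= {H1 H2 H3}.
have {u0} : 0 < (int_of_Z u)%:~R :> R by rewrite ltr0z.
have {v0} : 0 < (int_of_Z v)%:~R :> R by rewrite ltr0z.
have {w0} : 0 < (int_of_Z w)%:~R :> R by rewrite ltr0z.
move: (_ u)%:~R (_ v)%:~R (_ w)%:~R => U V W W0 V0 U0 H1 H2 H3.
(* The largest multiple of r below (x, y, z) is given by the least of the
   ratios x / U, y / V, z / W. *)
have below (s s' t t' : R) : 0 < s -> 0 < t -> s' / s <= t' / t ->
    0 <= t' - t * (s' / s).
  by move=> s0 t0 st; rewrite subr_ge0 mulrC -ler_pdivlMr.
have [xy|/ltW yx] := leP (x / U) (y / V).
  have [xz|/ltW zx] := leP (x / U) (z / W).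
    have := H1 (x / U) (y - V * (x / U)) (z - W * (x / U)).
    rewrite !subrK [U * _]mulrC divfK ?gt_eqF //.
    by apply; rewrite ?below // divr_ge0 // ltW.
  have := H3 (x - U * (z / W)) (y - V * (z / W)) (z / W).
  rewrite !subrK [W * _]mulrC divfK ?gt_eqF //.
  by apply; rewrite ?below // ?divr_ge0 ?(le_trans zx) // ltW.
have [yz|/ltW zy] := leP (y / V) (z / W).
  have := H2 (x - U * (y / V)) (y / V) (z - W * (y / V)).
  rewrite !subrK [V * _]mulrC divfK ?gt_eqF //.
  by apply; rewrite ?below // divr_ge0 // ltW.
have := H3 (x - U * (z / W)) (y - V * (z / W)) (z / W).
rewrite !subrK [W * _]mulrC divfK ?gt_eqF //.
by apply; rewrite ?below // ?divr_ge0 ?(le_trans zy) // ltW.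
Qed.

(** * Elimination of three masses by Cramer's rule *)

Definition column : Type := pexpr * pexpr * pexpr.

Definition det3 (u v w : column) : pexpr :=
  let: (u1, u2, u3) := u in let: (v1, v2, v3) := v in
  let: (w1, w2, w3) := w in
  (u1 * (v2 * w3 - v3 * w2) - u2 * (v1 * w3 - v3 * w1)
   + u3 * (v1 * w2 - v2 * w1))%P.

(** By Cramer's rule this is det3 k1 k2 k3 times the value of the linear form
(t1, t2, t3) at the solution of the system with columns k1, k2, k3 and
right-hand side v. *)
Definition cramer (k1 k2 k3 : column) (t1 t2 t3 : pexpr) (v : column) : pexpr :=
  (t1 * det3 v k2 k3 + t2 * det3 k1 v k3 + t3 * det3 k1 k2 v)%P.

(** With a fourth unknown n, with column u and weight t in the linear form,
the value of the form exceeds the value for n = 0 by n times the difference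
between t and the value of the form at the solution for the right-hand side
u. *)
Lemma cramer_excess (R : realDomainType) (x y z : R) (k1 k2 k3 u v : column)
    (t1 t2 t3 t : pexpr) (n1 n2 n3 n s : R) :
  let ev := peval x y z in
  let combination (row : column -> pexpr) := ev (row v) =
    n1 * ev (row k1) + n * ev (row u) + n2 * ev (row k2) + n3 * ev (row k3) in
  combination (fun w => w.1.1) -> combination (fun w => w.1.2) ->
  combination snd ->
  s = n1 * ev t1 + n * ev t + n2 * ev t2 + n3 * ev t3 ->
  ev (det3 k1 k2 k3) * s - ev (cramer k1 k2 k3 t1 t2 t3 v) =
  - n * ev (cramer k1 k2 k3 t1 t2 t3 u - det3 k1 k2 k3 * t)%P.
Proof.
move: k1 k2 k3 u v => [[? ?] ?] [[? ?] ?] [[? ?] ?] [[? ?] ?] [[? ?] ?] /=.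
by move=> -> -> -> ->; ring.
Qed.

(** * The three polynomial inequalities *)

Local Notation r12 := PX.
Local Notation r23 := PY.
Local Notation r34 := PZ.
Definition r13 : pexpr := r12 + r23.
Definition r24 : pexpr := r23 + r34.
Definition r14 : pexpr := r12 + r23 + r34.
Local Notation sq e := (e * e)%P.
Local Notation cube e := (e * e * e)%P.

(** Coefficients of the masses m_1, ..., m_4 in the three gap equations, each
multiplied by the square of the product of the distances to the other
bodies. *)
Definition K1 : column :=
  (sq (r13 * r14), sq (r12 * r14) - sq (r13 * r14),
   sq (r12 * r13) - sq (r12 * r14))%P.
Definition K2 : column :=
  (sq (r23 * r24), sq (r12 * r24), sq (r12 * r23) - sq (r12 * r24))%P.
Definition K3 : column :=
  (sq (r23 * r34) - sq (r34 * r13), sq (r34 * r13), sq (r23 * r13))%P.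
Definition K4 : column :=
  (sq (r34 * r24) - sq (r34 * r14), sq (r34 * r14) - sq (r24 * r14),
   sq (r24 * r14))%P.

Definition dist_prod : pexpr := r12 * r23 * r34 * r13 * r24 * r14.

(** Coefficients of the masses in dist_prod times the half trace, with the same
scaling as in [K1], ..., [K4]. *)
Definition t1 : pexpr :=
  r23 * r34 * r24 * (cube (r13 * r14) + cube (r12 * r14) + cube (r12 * r13)).
Definition t2 : pexpr :=
  r34 * r13 * r14 * (cube (r23 * r24) + cube (r12 * r24) + cube (r12 * r23)).
Definition t3 : pexpr :=
  r12 * r24 * r14 * (cube (r34 * r13) + cube (r23 * r13) + cube (r23 * r34)).
Definition t4 : pexpr :=
  r12 * r23 * r13 * (cube (r24 * r14) + cube (r34 * r14) + cube (r34 * r24)).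

Definition system_det : pexpr := det3 K1 K3 K4.

Definition system_trace (v : column) : pexpr := cramer K1 K3 K4 t1 t3 t4 v.

Lemma system_det_gt0 (R : realDomainType) (x y z : R) :
  0 < x -> 0 < y -> 0 < z -> 0 < peval x y z system_det.
Proof.
move=> x0 y0 z0.
(* All coefficients of the determinant are nonnegative; strictness comes from
   the coefficient of (x y z)^4 being at least 1. *)
have H : nneg_octant R (system_det - sq (sq (r12 * r23 * r34))).
  by apply: nneg_coefsP; vm_compute.
have := H x y z (ltW x0) (ltW y0) (ltW z0).
rewrite [peval x y z (_ - _)]/(peval x y z system_det - _) subr_ge0.
by apply: lt_le_trans; rewrite /= !mulr_gt0.
Qed.

(** The polynomial changes sign with z - x, as the second and third bodies
exchange their roles in the linear program on the plane of symmetry x = z;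
in the variables x, y, z - x its coefficients are nonnegative. *)
Lemma massless_excess_ge0 (R : realDomainType) (x y z : R) :
  0 <= x -> 0 <= y -> x <= z ->
  0 <= peval x y z (system_trace K2 - system_det * t2)%P.
Proof.
move=> x0 y0 xz.
have H : nneg_octant R
    (psubst r12 r23 (r12 + r34) (system_trace K2 - system_det * t2)).
  by apply: nneg_coefsP; vm_compute.
have /= := nneg_octant_subst H (x := x) (y := y) (z := z - x).
by rewrite subrKC; apply; rewrite ?subr_ge0.
Qed.

(** The ray (4, 1, 7) is close to the direction where the polynomial is
relatively smallest. A near minimum inside a cone forces negative
coefficients, so this ray is made an edge. Two edges starting from it must in
addition form an acute angle for the quadratic part of the polynomial
transversally to the ray, which is why the cone opposite to (0, 1, 0) is cut
again, by the ray (1, 0, 1). The ray (1, 1, 4), proportional to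
(4, 1, 7) + 3 (0, 1, 0) + 9 (0, 0, 1), deals with the neighbourhood of
(0, 0, 1), where the lowest order terms in x and y have negative mixed
coefficients. *)
Lemma trace_gap_ge0 (R : realFieldType) :
  nneg_octant R (PC 699 * (dist_prod * system_det)
                 - PC 20 * system_trace (r12, r23, r34)).
Proof.
apply: (@nneg_octant_stellar R 4 1 7) => //.
- by apply: (@nneg_octant_stellar R 1 3 9) => //;
    apply: nneg_coefsP; vm_compute.
- by apply: nneg_octant_split; apply: nneg_coefsP; vm_compute.
- by apply: nneg_coefsP; vm_compute.
Qed.

(** * The bound in terms of gaps and masses *)

Definition gap_equations (R : realFieldType) (m1 m2 m3 m4 x y z : R) : Prop :=
  [/\ x = (m1 + m2) / x ^+ 2 + m3 * ((x + y) ^- 2 - y ^- 2)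
          + m4 * ((x + y + z) ^- 2 - (y + z) ^- 2),
      y = (m2 + m3) / y ^+ 2 + m1 * ((x + y) ^- 2 - x ^- 2)
          + m4 * ((y + z) ^- 2 - z ^- 2) &
      z = (m3 + m4) / z ^+ 2 + m2 * ((y + z) ^- 2 - y ^- 2)
          + m1 * ((x + y + z) ^- 2 - (x + y) ^- 2)].

Definition half_trace (R : realFieldType) (m1 m2 m3 m4 x y z : R) : R :=
  (m1 + m2) / x ^+ 3 + (m2 + m3) / y ^+ 3 + (m3 + m4) / z ^+ 3
  + (m1 + m3) / (x + y) ^+ 3 + (m2 + m4) / (y + z) ^+ 3
  + (m1 + m4) / (x + y + z) ^+ 3.

Lemma gap_sums_neq0 (R : realDomainType) (x y z : R) :
  0 < x -> 0 < y -> 0 < z ->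
  [&& x != 0, y != 0, z != 0, x + y != 0, y + z != 0 & x + y + z != 0].
Proof. by move=> x0 y0 z0; rewrite !gt_eqF ?addr_gt0. Qed.

(** The second mass multiplies the excess in the Cramer identity, so that
replacing it by zero, with m1, m3, m4 adjusted to keep the gaps, can only
increase the half trace when x <= z. *)
Lemma half_trace_le_of_gap_le (R : realFieldType) (m1 m2 m3 m4 x y z : R) :
  0 < x -> 0 < y -> 0 < z -> 0 < m2 -> x <= z ->
  gap_equations m1 m2 m3 m4 x y z ->
  half_trace m1 m2 m3 m4 x y z <= 699 / 20.
Proof.
move=> x0 y0 z0 m20 xz [e1 e2 e3]; set T := half_trace _ _ _ _ _ _ _.
have /and5P[xn0 yn0 zn0 r13n0 /andP[r24n0 r14n0]] := gap_sums_neq0 x0 y0 z0.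
pose n1 := m1 / (x * (x + y) * (x + y + z)) ^+ 2.
pose n2 := m2 / (x * y * (y + z)) ^+ 2.
pose n3 := m3 / (y * z * (x + y)) ^+ 2.
pose n4 := m4 / (z * (y + z) * (x + y + z)) ^+ 2.
have E1 : x = n1 * peval x y z K1.1.1 + n2 * peval x y z K2.1.1 +
          n3 * peval x y z K3.1.1 + n4 * peval x y z K4.1.1.
  by rewrite [LHS]e1 /n1 /n2 /n3 /n4 /=; field; do ?[apply/andP; split].
have E2 : y = n1 * peval x y z K1.1.2 + n2 * peval x y z K2.1.2 +
          n3 * peval x y z K3.1.2 + n4 * peval x y z K4.1.2.
  by rewrite [LHS]e2 /n1 /n2 /n3 /n4 /=; field; do ?[apply/andP; split].
have E3 : z = n1 * peval x y z K1.2 + n2 * peval x y z K2.2 +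
          n3 * peval x y z K3.2 + n4 * peval x y z K4.2.
  by rewrite [LHS]e3 /n1 /n2 /n3 /n4 /=; field; do ?[apply/andP; split].
have ET : peval x y z dist_prod * T =
          n1 * peval x y z t1 + n2 * peval x y z t2 +
          n3 * peval x y z t3 + n4 * peval x y z t4.
  by rewrite /T /half_trace /n1 /n2 /n3 /n4 /=; field;
    do ?[apply/andP; split].
have := cramer_excess (v := (r12, r23, r34)) E1 E2 E3 ET.
rewrite -/system_det -/(system_trace _) => excess.
have n20 : 0 <= n2 by rewrite divr_ge0 ?sqr_ge0 // ltW.
have excess0 := massless_excess_ge0 (ltW x0) (ltW y0) xz.
have det0 := system_det_gt0 x0 y0 z0.
have prod0 : 0 < peval x y z dist_prod by rewrite /= !mulr_gt0 ?addr_gt0.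
have le1 : peval x y z system_det * (peval x y z dist_prod * T) <=
           peval x y z (system_trace (r12, r23, r34)).
  by rewrite -subr_le0 excess mulNr oppr_le0 mulr_ge0.
have le2 : 20 * peval x y z (system_trace (r12, r23, r34)) <=
           699 * (peval x y z dist_prod * peval x y z system_det).
  by rewrite -subr_ge0; exact: trace_gap_ge0 (ltW x0) (ltW y0) (ltW z0).
move: (peval x y z system_det) (peval x y z dist_prod)
  (peval x y z (system_trace _)) det0 prod0 le1 le2 => d pi n d0 pi0 le1 le2.
rewrite -(ler_pM2l (mulr_gt0 pi0 d0)).
apply: (@le_trans _ _ n); first by apply: le_trans le1; lra.
lra.
Qed.

Lemma half_trace_le (R : realFieldType) (m1 m2 m3 m4 x y z : R) :
  0 < x -> 0 < y -> 0 < z -> 0 < m2 -> 0 < m3 ->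
  gap_equations m1 m2 m3 m4 x y z ->
  half_trace m1 m2 m3 m4 x y z <= 699 / 20.
Proof.
move=> x0 y0 z0 m20 m30 eqs; have [xz|/ltW zx] := leP x z.
  exact: half_trace_le_of_gap_le.
(* The reflected configuration has gaps z, y, x. *)
have r14C : z + y + x = x + y + z by ring.
have := @half_trace_le_of_gap_le R m4 m3 m2 m1 z y x z0 y0 x0 m30 zx.
rewrite /gap_equations /half_trace !r14C [z + y]addrC [y + x]addrC => H.
have [e1 e2 e3] := eqs.
apply: (le_trans _ (H _)); first lra.
split; [rewrite [LHS]e3|rewrite [LHS]e2|rewrite [LHS]e1]; ring.
Qed.

(** * Partial derivatives of the potential *)

(** Directional derivatives only see the restriction of the function to a
line, and on the line through q in the direction of a basis vector every gap
q_i - q_j is an affine function of the parameter. *)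
Lemma derive_line (R : realType) (n : nat) (f : 'rV[R]_n.+1 -> R)
    (v x : 'rV[R]_n.+1) :
  'D_v f x = 'D_1 (fun h : R => f (h *: v + x)) 0.
Proof.
apply: (congr1 (fun F : R -> R => lim (F @ 0^')%classic)).
by apply/funext => h /=; rewrite scale0r add0r addr0 [h *: 1]mulr1.
Qed.

Lemma is_derive_pair_sum (R : realType) (n k : nat)
    (A d u : 'I_n -> 'I_n -> R) :
  (forall i j : 'I_n, (i < j)%N -> u i j != 0) ->
  is_derive (0 : R) (1 : R)
    (fun h => \sum_(i < n) \sum_(j < n | (i < j)%N)
      A i j * (h * d i j + u i j) ^- k.+1)
    (\sum_(i < n) \sum_(j < n | (i < j)%N)
      - (k.+1)%:R * A i j * d i j * u i j ^- k.+2).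
Proof.
move=> u0.
pose F (i j : 'I_n) (h : R) : R :=
  if (i < j)%N then A i j * (h * d i j + u i j) ^- k.+1 else 0.
have dF i j : is_derive (0 : R) (1 : R) (F i j)
   (if (i < j)%N then - (k.+1)%:R * A i j * d i j * u i j ^- k.+2 else 0).
  rewrite /F; case: ifP => [ij|_]; last exact: is_derive_cst.
  have uij : 0 * d i j + u i j != 0 by rewrite mul0r add0r u0.
  have dl : is_derive (0 : R) (1 : R) (fun h : R => h * d i j + u i j) (d i j).
    apply: is_derive_eq.
    by rewrite addr0 scaler0 add0r /GRing.scale /= mulr1.
  have dV := is_deriveV (f := fun h : R => h * d i j + u i j) uij dl.
  have dX := is_deriveX k.+1 dV.
  have dC : is_derive (0 : R) (1 : R) (cst (A i j)) 0 by exact: is_derive_cst.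
  have -> : (fun h : R => A i j * (h * d i j + u i j) ^- k.+1) =
            cst (A i j) * (fun h : R => (h * d i j + u i j)^-1) ^+ k.+1.
    by apply/funext => h; rewrite exprfctE -exprVn.
  apply: (is_derive_eq (is_deriveM dC dX)).
  by rewrite scaler0 addr0 mul0r add0r /GRing.scale /= -!exprVn !exprS; ring.
have := is_derive_sum (fun i => is_derive_sum (dF i)).
rewrite [X in is_derive _ _ X _](_ : _ = fun h =>
   \sum_(i < n) \sum_(j < n | (i < j)%N)
     A i j * (h * d i j + u i j) ^- k.+1); last first.
  apply/funext => h; rewrite fct_sumE; apply: eq_bigr => i _.
  by rewrite fct_sumE [RHS]big_mkcond.
by under eq_bigr do rewrite -big_mkcond.
Qed.

Definition gap_slope (R : realType) (k i j : 'I_4) : R :=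
  (i == k)%:R - (j == k)%:R.

Lemma gap_shift (R : realType) (k i j : 'I_4) (q : 'rV[R]_4) (h : R) :
  (h *: delta_mx 0 k + q) 0 i - (h *: delta_mx 0 k + q) 0 j =
  h * gap_slope R k i j + (q 0 i - q 0 j).
Proof. by rewrite !mxE /= /gap_slope; ring. Qed.

Lemma ordered_bodies_near (R : realType) (k : 'I_4) (q : 'rV[R]_4) :
  ordered_bodies q ->
  \forall h \near (0 : R), ordered_bodies (h *: delta_mx 0 k + q).
Proof.
move=> oq; rewrite /ordered_bodies.
pose ord (i j : 'I_4) (h : R) := (i < j)%N ->
  (h *: delta_mx 0 k + q) 0 i < (h *: delta_mx 0 k + q) 0 j.
refine (@filter_forall R 'I_4 (fun i h => forall j, ord i j h)
  (nbhs (0 : R)) _ _) => i.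
refine (@filter_forall R 'I_4 (fun j h => ord i j h)
  (nbhs (0 : R)) _ _) => j; rewrite /ord.
have [/oq ij|ij] := boolP (i < j)%N; last by apply: nearW => h.
have cl : ((fun h : R => h * gap_slope R k i j + (q 0 i - q 0 j)) @ (0 : R) -->
    0 * gap_slope R k i j + (q 0 i - q 0 j))%classic.
  by apply: cvgD; [apply: cvgM; [exact: cvg_id|exact: cvg_cst]|exact: cvg_cst].
have l0 : 0 * gap_slope R k i j + (q 0 i - q 0 j) < 0.
  by rewrite mul0r add0r subr_lt0.
near=> h => _; rewrite -subr_lt0 gap_shift.
by near: h; exact: cvgr_lt cl _ l0.
Unshelve. all: by end_near. Qed.

Lemma partial_V41 (R : realType) (m : 'I_4 -> R) (k : 'I_4) (q : 'rV[R]_4) :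
  ordered_bodies q ->
  partial k (V41 m) q =
  \sum_(i < 4) \sum_(j < 4 | (i < j)%N)
    m i * m j * gap_slope R k i j * (q 0 i - q 0 j) ^- 2.
Proof.
move=> oq; rewrite /partial derive_line.
have u0 (i j : 'I_4) : (i < j)%N -> q 0 i - q 0 j != 0.
  by move=> /oq ij; rewrite lt_eqF // subr_lt0.
(* Since q_i < q_j, the absolute value is the opposite of q_i - q_j. *)
rewrite (near_eq_derive (g := fun h : R => \sum_(i < 4) \sum_(j < 4 | (i < j)%N)
    - (m i * m j) * (h * gap_slope R k i j + (q 0 i - q 0 j)) ^- 1)).
  have /= H := is_derive_pair_sum 0 (fun i j => - (m i * m j))
    (gap_slope R k) u0.
  rewrite (derive_val (is_derive := H)).
  by apply: eq_bigr => i _; apply: eq_bigr => j _; ring.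
near=> h; rewrite /V41; apply: eq_bigr => i _; apply: eq_bigr => j ij.
rewrite -gap_shift expr1 ltr0_norm ?invrN ?mulrN ?mulNr // subr_lt0.
have oh : ordered_bodies (h *: delta_mx 0 k + q).
  by near: h; exact: ordered_bodies_near.
exact: oh.
Unshelve. all: by end_near. Qed.

Lemma partial_partial_V41 (R : realType) (m : 'I_4 -> R) (k : 'I_4)
    (q : 'rV[R]_4) :
  ordered_bodies q ->
  partial k (partial k (V41 m)) q =
  \sum_(i < 4) \sum_(j < 4 | (i < j)%N)
    - 2 * m i * m j * gap_slope R k i j ^+ 2 * (q 0 i - q 0 j) ^- 3.
Proof.
move=> oq; rewrite {1}/partial derive_line.
have u0 (i j : 'I_4) : (i < j)%N -> q 0 i - q 0 j != 0.
  by move=> /oq ij; rewrite lt_eqF // subr_lt0.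
rewrite (near_eq_derive (g := fun h : R => \sum_(i < 4) \sum_(j < 4 | (i < j)%N)
    m i * m j * gap_slope R k i j *
    (h * gap_slope R k i j + (q 0 i - q 0 j)) ^- 2)).
  have /= H := is_derive_pair_sum 1 (fun i j => m i * m j * gap_slope R k i j)
    (gap_slope R k) u0.
  rewrite (derive_val (is_derive := H)).
  by apply: eq_bigr => i _; apply: eq_bigr => j _; rewrite expr2; ring.
near=> h.
rewrite partial_V41; last by near: h; exact: ordered_bodies_near.
by apply: eq_bigr => i _; apply: eq_bigr => j _; rewrite gap_shift.
Unshelve. all: by end_near. Qed.

(** * From central configurations to gap equations *)

Definition i0 : 'I_4 := @Ordinal 4 0 isT.
Definition i1 : 'I_4 := @Ordinal 4 1 isT.
Definition i2 : 'I_4 := @Ordinal 4 2 isT.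
Definition i3 : 'I_4 := @Ordinal 4 3 isT.

Lemma sum_I4 (V : nmodType) (F : 'I_4 -> V) :
  \sum_(i < 4) F i = F i0 + F i1 + F i2 + F i3.
Proof.
rewrite !big_ord_recl big_ord0 addr0 !addrA.
by congr (F _ + F _ + F _ + F _); apply: val_inj.
Qed.

Lemma sum_pairs_I4 (V : nmodType) (F : 'I_4 -> 'I_4 -> V) :
  \sum_(i < 4) \sum_(j < 4 | (i < j)%N) F i j =
  F i0 i1 + F i0 i2 + F i0 i3 + F i1 i2 + F i1 i3 + F i2 i3.
Proof.
under eq_bigr do rewrite big_mkcond sum_I4.
by rewrite sum_I4 /= !add0r !addr0 !addrA.
Qed.

Definition gap (R : realType) (c : 'rV[R]_4) (i j : 'I_4) : R := c 0 j - c 0 i.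

Lemma gap_gt0 (R : realType) (c : 'rV[R]_4) (i j : 'I_4) :
  ordered_bodies c -> (i < j)%N -> 0 < gap c i j.
Proof. by move=> oc ij; rewrite subr_gt0 oc. Qed.

Lemma gapsE (R : realType) (c : 'rV[R]_4)
    (x := gap c i0 i1) (y := gap c i1 i2) (z := gap c i2 i3) :
  ((c 0 i0 - c 0 i1 = - x) * (c 0 i1 - c 0 i2 = - y) *
   (c 0 i2 - c 0 i3 = - z) * (c 0 i0 - c 0 i2 = - (x + y)) *
   (c 0 i1 - c 0 i3 = - (y + z)) * (c 0 i0 - c 0 i3 = - (x + y + z)))%type.
Proof. by do !split; rewrite /x /y /z /gap; ring. Qed.

Lemma central_configuration_gaps (R : realType) (m : 'I_4 -> R)
    (c : 'rV[R]_4) :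
  (forall i, 0 < m i) -> central_configuration m (-1) c ->
  gap_equations (m i0) (m i1) (m i2) (m i3)
    (gap c i0 i1) (gap c i1 i2) (gap c i2 i3).
Proof.
move=> m0 [oc [g cc]].
have x0 := gap_gt0 oc (isT : (i0 < i1)%N).
have y0 := gap_gt0 oc (isT : (i1 < i2)%N).
have z0 := gap_gt0 oc (isT : (i2 < i3)%N).
have gapF i j : gap c i j = (m i)^-1 * partial i (V41 m) c
                            - (m j)^-1 * partial j (V41 m) c.
  by rewrite !cc /gap; ring.
move: (gapF i0 i1) (gapF i1 i2) (gapF i2 i3).
rewrite !partial_V41 // !sum_pairs_I4 /gap_slope -!val_eqE /= !gapsE.
move: (gap c i0 i1) (gap c i1 i2) (gap c i2 i3) x0 y0 z0.
move: (m i0) (m i1) (m i2) (m i3) (m0 i0) (m0 i1) (m0 i2) (m0 i3).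
move=> m1 m2 m3 m4 /lt0r_neq0 m1n0 /lt0r_neq0 m2n0 /lt0r_neq0 m3n0.
move=> /lt0r_neq0 m4n0 x y z x0 y0 z0 e1 e2 e3.
have /and5P[xn0 yn0 zn0 r13n0 /andP[r24n0 r14n0]] := gap_sums_neq0 x0 y0 z0.
by split; [rewrite [LHS]e1|rewrite [LHS]e2|rewrite [LHS]e3]; field;
  do ?[apply/andP; split].
Qed.

Lemma trace_W_mx (R : realType) (m : 'I_4 -> R) (c : 'rV[R]_4) :
  (forall i, 0 < m i) -> ordered_bodies c ->
  \tr (W_mx m c) = (2 * half_trace (m i0) (m i1) (m i2) (m i3)
    (gap c i0 i1) (gap c i1 i2) (gap c i2 i3))%:C.
Proof.
move=> m0 oc.
have -> : \tr (W_mx m c) =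
    (\sum_(k < 4) (m k)^-1 * partial k (partial k (V41 m)) c)%:C.
  by rewrite /mxtrace rmorph_sum; apply: eq_bigr => k _; rewrite mxE.
congr (_%:C); rewrite sum_I4 !partial_partial_V41 // !sum_pairs_I4.
rewrite /gap_slope -!val_eqE /= !gapsE /half_trace.
have x0 := gap_gt0 oc (isT : (i0 < i1)%N).
have y0 := gap_gt0 oc (isT : (i1 < i2)%N).
have z0 := gap_gt0 oc (isT : (i2 < i3)%N).
have /and5P[xn0 yn0 zn0 r13n0 /andP[r24n0 r14n0]] := gap_sums_neq0 x0 y0 z0.
have mn0 i : m i != 0 by rewrite gt_eqF.
by field; rewrite ?mn0; do ?[apply/andP; split].
Qed.

Theorem theorem10 (R : realType) (m : 'I_4 -> R) (c : 'rV[R]_4)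
    (m_gt0 : forall i : 'I_4, 0 < m i)
    (c_cc : central_configuration m (-1) c) :
  \tr (W_mx m c) < 70 :> R[i].
Proof.
have [oc _] := c_cc.
have -> : 70 = 70%:C :> R[i] by rewrite rmorph_nat.
rewrite trace_W_mx // ltcR.
have eqs := central_configuration_gaps m_gt0 c_cc.
have := half_trace_le (gap_gt0 oc (isT : (i0 < i1)%N))
  (gap_gt0 oc (isT : (i1 < i2)%N)) (gap_gt0 oc (isT : (i2 < i3)%N))
  (m_gt0 i1) (m_gt0 i2) eqs.
lra.
Qed.
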